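(* Let $n\ge 1$. Totally symmetric self-complementary plane partitions inside a $2n\times 2n\times 2n$ box are in bijection with tournaments on the vertex set $\{1,2,\dots,n\}$ satisfying the following condition on upsets: for all $1\le u<v\le n$, if vertex $v$ has $k$ upsets with vertices in $\{u,u+1,\dots,v-1\}$, then vertex $v-1$ has at most $k$ upsets with vertices in $\{u,u+1,\dots,v-2\}$.
   Context: A tournament on $\{1,\dots,n\}$ is a choice, for every pair $i<j$, of a winner of the game between $i$ and $j$. The game between $i<j$ is an upset if $j$ wins; ''vertex $v$ has $k$ upsets with vertices in a set $W\subseteq\{1,\dots,v-1\}$'' means $v$ beats exactly $k$ vertices of $W$. A plane partition inside a $2n\times 2n\times 2n$ box is an array $t=(t_{i,j})_{1\le i,j\le 2n}$ of integers in $\{0,\dots,2n\}$ weakly decreasing along rows and columns; it is totally symmetric if the set of cubes $\{(i,j,k):1\le k\le t_{i,j}\}$ is invariant under all permutations of the coordinates, and self-complementary if $t_{i,j}+t_{2n+1-i,2n+1-j}=2n$ for all $i,j$. *)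

(* Defs.v *)
From mathcomp Require Import all_boot all_fingroup all_algebra.

Set Implicit Arguments.
Unset Strict Implicit.
Unset Printing Implicit Defensive.

(* Indices are zero-based: the label i of {1, ..., m} is the ordinal of value
   i - 1 in 'I_m.  Entries of plane partitions are not shifted. *)

Section PlanePartitions.

Variable m : nat.

Implicit Type t : 'M['I_m.+1]_m.

Definition plane_partition t : bool :=
  [forall i : 'I_m, forall j : 'I_m, forall j' : 'I_m,
    (j <= j') ==> (t i j' <= t i j)] &&
  [forall i : 'I_m, forall i' : 'I_m, forall j : 'I_m,
    (i <= i') ==> (t i' j <= t i j)].

Definition cube : predArgType := {ffun 'I_3 -> 'I_m}.

Definition coord1 (c : cube) : 'I_m := c (@Ordinal 3 0 isT).
Definition coord2 (c : cube) : 'I_m := c (@Ordinal 3 1 isT).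
Definition coord3 (c : cube) : 'I_m := c (@Ordinal 3 2 isT).

(* The one-based condition 1 <= k <= t_(i,j) reads k < t i j here. *)
Definition cubes t : {set cube} :=
  [set c | coord3 c < t (coord1 c) (coord2 c)].

Definition permute_coords (s : 'S_3) (c : cube) : cube := [ffun a => c (s a)].

Definition totally_symmetric t : bool :=
  [forall s : 'S_3, permute_coords s @: cubes t == cubes t].

Definition self_complementary t : bool :=
  [forall i : 'I_m, forall j : 'I_m, t i j + t (rev_ord i) (rev_ord j) == m].

End PlanePartitions.

Definition tsscpp (n : nat) : predArgType :=
  {t : 'M['I_(2 * n).+1]_(2 * n) |
    [&& plane_partition t, totally_symmetric t & self_complementary t]}.

Section Tournaments.

Variable n : nat.

(* [T (i, j)] means that i beats j; the diagonal, where there is no game, is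
   set to false so that a tournament has a single encoding. *)
Implicit Type T : {ffun 'I_n * 'I_n -> bool}.

Definition is_tournament T : bool :=
  [forall i : 'I_n, ~~ T (i, i)] &&
  [forall i : 'I_n, forall j : 'I_n, (i < j) ==> (T (j, i) == ~~ T (i, j))].

Definition upsets_with T (v : 'I_n) (W : {set 'I_n}) : nat :=
  #|[set w in W | T (v, w)]|.

(* Half-open interval {u, u + 1, ..., v - 1}. *)
Definition vertices_from_to (u v : 'I_n) : {set 'I_n} :=
  [set w : 'I_n | u <= w < v].

(* [p] is the vertex v - 1. *)
Definition upset_condition T : bool :=
  [forall u : 'I_n, forall v : 'I_n, forall p : 'I_n,
    ((u < v) && (v == p.+1 :> nat)) ==>
    (upsets_with T p (vertices_from_to u p)
       <= upsets_with T v (vertices_from_to u v))].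

End Tournaments.

Definition upset_tournament (n : nat) : predArgType :=
  {T : {ffun 'I_n * 'I_n -> bool} | is_tournament T && upset_condition T}.

(* Main.v *)
Require Import Defs.
From mathcomp Require Import all_boot all_fingroup all_algebra.
From mathcomp Require Import zify.

(** Self-complementarity determines a totally symmetric partition of the
    2n x 2n x 2n box from its cubes (n + i, n + j, k) with i, j, k < n; these
    form a down-closed set A, symmetric in i and j, and the only other constraint
    is that A i j k forces j + k + 2 <= n (zero-based).  The slice of A at height
    k = n - 1 - v is therefore a symmetric partition in a v x v square; it is
    determined by the lengths D v u of its u-th diagonals.  These satisfy
    D v v = 0 and D v u - D v (u + 1) in {0, 1}, and the nesting of the slices
    says that D v u is weakly increasing in v.  Letting v beat u < v exactly when
    D v u - D v (u + 1) = 1 makes D v u the number of upsets of v with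
    {u, ..., v - 1}, and the nesting becomes the upset condition. *)

Set Implicit Arguments.
Unset Strict Implicit.
Unset Printing Implicit Defensive.

(** * Numbers as lengths of initial segments *)

Lemma eq_from_ltn (a b : nat) : (forall k, (k < a) = (k < b)) -> a = b.
Proof. by move=> h; move: (h a) (h b); lia. Qed.

(** A down-closed predicate holds on an initial segment, so counting its true values below [N]
    measures that segment, capped at [N]. *)
Lemma ltn_sum_down (Q : nat -> bool) (N i : nat) :
  (forall j, Q j.+1 -> Q j) ->
  (i < \sum_(0 <= j < N) Q j) = (i < N) && Q i.
Proof.
move=> Qdown.
have Qmono j l : Q (j + l) -> Q j.
  by elim: l => [|l IHl]; rewrite ?addn0 // addnS => /Qdown.
have sum_le (M : nat) : \sum_(0 <= j < M) Q j <= M.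
  by elim: M => [|M IHM]; rewrite ?big_nil // big_nat_recr //=; case: (Q M); lia.
case: (ltnP i N) => [iN|Ni] /=; last by have := sum_le N; lia.
rewrite (@big_cat_nat _ _ _ i.+1) //=.
case: (boolP (Q i)) => [Qi|nQi].
  suff -> : \sum_(0 <= j < i.+1) Q j = i.+1 by lia.
  rewrite (eq_big_nat _ _ (F2 := fun=> 1)); first by rewrite sum_nat_const_nat; lia.
  by move=> j /andP [_ ji]; rewrite (@Qmono j (i - j)) // subnKC.
have -> : \sum_(i.+1 <= j < N) Q j = 0.
  rewrite big_nat big1 // => j /andP [ij _].
  case: (boolP (Q j)) => // Qj; case/negP: nQi.
  by apply: (@Qmono i (j - i)); rewrite subnKC // ltnW.
by rewrite big_nat_recr //= (negbTE nQi); have := sum_le i; lia.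
Qed.

(** * Plane partitions as sets of cubes over the natural numbers *)

Section Extension.

Variables (m : nat) (f : 'I_m -> 'I_m -> bool).

(** Natural-number indices, with value false out of range, allow shifts such as [n + i] without
    casts between ordinals. *)
Definition extend i j : bool :=
  [exists a : 'I_m, exists b : 'I_m,
    [&& a == i :> nat, b == j :> nat & f a b]].

Lemma extendE (a b : 'I_m) : extend a b = f a b.
Proof.
apply/existsP/idP => [[a' /existsP [b' /and3P [/eqP aa /eqP bb]]]|fab].
  by rewrite (val_inj aa) (val_inj bb).
by exists a; apply/existsP; exists b; rewrite !eqxx.
Qed.

End Extension.

(** The two symmetries are adjacent transpositions, which generate all permutations and carry
    [solid_down] to the other coordinates. *)
Record tssc_solid (m : nat) (P : nat -> nat -> nat -> bool) : Prop := {
  solid_box : forall i j k, P i j k -> [&& i < m, j < m & k < m];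
  solid_down : forall i j k, P i j k.+1 -> P i j k;
  solid_symL : forall i j k, P i j k = P j i k;
  solid_symR : forall i j k, P i j k = P i k j;
  solid_compl : forall i j k, i < m -> j < m -> k < m ->
    P (m - i.+1) (m - j.+1) (m - k.+1) = ~~ P i j k }.

Lemma down_le (P : nat -> bool) (k k' : nat) :
  (forall j, P j.+1 -> P j) -> k' <= k -> P k -> P k'.
Proof.
move=> Pdown /subnK <-; elim: (k - k') => [|l IHl]; rewrite ?add0n // addSn.
by move/Pdown.
Qed.

Section Cells.

Variable m : nat.
Implicit Type t : 'M['I_m.+1]_m.

Definition cell t i j k := extend (fun a b => k < t a b) i j.

Definition mx_of_solid (P : nat -> nat -> nat -> bool) : 'M['I_m.+1]_m :=
  (\matrix_(i, j) inord (\sum_(0 <= k < m) P i j k))%R.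

Lemma cell_inj t t' : (forall i j k, cell t i j k = cell t' i j k) -> t = t'.
Proof.
move=> eq_tt'; apply/matrixP=> i j; apply/val_inj/eq_from_ltn => k.
by have := eq_tt' i j k; rewrite /cell !extendE.
Qed.

Definition cube_of (x y z : 'I_m) : cube m :=
  [ffun a : 'I_3 => if a == 0 :> nat then x else if a == 1 :> nat then y else z].

Lemma mem_cubes t x y z : (cube_of x y z \in cubes t) = (z < t x y).
Proof. by rewrite inE /coord1 /coord2 /coord3 !ffunE. Qed.

Lemma cubeE (c : cube m) : c = cube_of (coord1 c) (coord2 c) (coord3 c).
Proof.
apply/ffunP => a; rewrite ffunE /coord1 /coord2 /coord3.
by case: a => [] [|[|[|//]]] lt /=; congr (c _); apply: val_inj.
Qed.

Lemma permute_coords_inj (s : 'S_3) : injective (@permute_coords m s).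
Proof.
move=> c1 c2 /ffunP eq_c; apply/ffunP=> a.
by have := eq_c (s^-1%g a); rewrite !ffunE permKV.
Qed.

Lemma permute_cubes t (s : 'S_3) c :
  totally_symmetric t -> (permute_coords s c \in cubes t) = (c \in cubes t).
Proof.
by move/forallP/(_ s)/eqP=> {1}<-; rewrite (mem_imset _ _ (@permute_coords_inj s)).
Qed.

Lemma cell_solid t :
  totally_symmetric t -> self_complementary t -> tssc_solid m (cell t).
Proof.
move=> t_sym t_compl.
have box i j k : cell t i j k -> [&& i < m, j < m & k < m].
  case/existsP=> a /existsP [b /and3P [/eqP <- /eqP <- kt]].
  by rewrite !ltn_ord /= (leq_trans kt) // -ltnS.
have symL (i j k : 'I_m) : (k < t i j) = (k < t j i).
  rewrite -!mem_cubes.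
  rewrite -(permute_cubes (tperm (@Ordinal 3 0 isT) (@Ordinal 3 1 isT)) _ t_sym).
  by rewrite [permute_coords _ _]cubeE /coord1 /coord2 /coord3 !ffunE tpermL tpermR tpermD // !ffunE.
have symR (i j k : 'I_m) : (k < t i j) = (j < t i k).
  rewrite -!mem_cubes.
  rewrite -(permute_cubes (tperm (@Ordinal 3 1 isT) (@Ordinal 3 2 isT)) _ t_sym).
  by rewrite [permute_coords _ _]cubeE /coord1 /coord2 /coord3 !ffunE tpermL tpermR tpermD // !ffunE.
split=> //.
- move=> i j k /existsP [a /existsP [b /and3P [ai bj kt]]].
  by apply/existsP; exists a; apply/existsP; exists b; rewrite ai bj ltnW.
- have imp i j k : cell t i j k -> cell t j i k.
    move=> c; case/and3P: (box _ _ _ c) (c) => im jm km.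
    rewrite -[i]/(val (Ordinal im)) -[j]/(val (Ordinal jm)) -[k]/(val (Ordinal km)).
    by rewrite /cell !extendE symL.
  by move=> i j k; apply/idP/idP; apply: imp.
- have imp i j k : cell t i j k -> cell t i k j.
    move=> c; case/and3P: (box _ _ _ c) (c) => im jm km.
    rewrite -[i]/(val (Ordinal im)) -[j]/(val (Ordinal jm)) -[k]/(val (Ordinal km)).
    by rewrite /cell !extendE symR.
  by move=> i j k; apply/idP/idP; apply: imp.
move=> i j k im jm km.
rewrite -[i]/(val (Ordinal im)) -[j]/(val (Ordinal jm)).
rewrite -[m - _.+1 in X in cell _ X]/(val (rev_ord (Ordinal im))).
rewrite -[m - _.+1 in X in cell _ _ X]/(val (rev_ord (Ordinal jm))).
rewrite /cell !extendE.
(* Opposite entries are a and m - a, and m - k.+1 < m - a exactly when a <= k. *)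
by move/forallP/(_ (Ordinal im))/forallP/(_ (Ordinal jm))/eqP: t_compl; lia.
Qed.

Section MxOfSolid.

Variable P : nat -> nat -> nat -> bool.
Hypothesis P_solid : tssc_solid m P.

Lemma ltn_mx_of_solid (i j : 'I_m) k : (k < mx_of_solid P i j) = P i j k.
Proof.
have down := solid_down P_solid.
(* The count is at most m, so [inord] does not fall back to its default value. *)
rewrite mxE inordK; last first.
  by rewrite leqNgt ltnS ltn_sum_down ?ltnn // => l; apply: down.
rewrite ltn_sum_down; last by move=> l; apply: down.
by case: (boolP (P i j k)) => [/(solid_box P_solid)|]; rewrite ?andbF ?andbT // => /and3P [].
Qed.

Lemma cell_mx_of_solid i j k : cell (mx_of_solid P) i j k = P i j k.
Proof.
apply/idP/idP => [/existsP [a /existsP [b /and3P [/eqP <- /eqP <-]]]|Pijk].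
  by rewrite ltn_mx_of_solid.
case/and3P: (solid_box P_solid Pijk) => im jm _.
apply/existsP; exists (Ordinal im); apply/existsP; exists (Ordinal jm).
by rewrite !eqxx ltn_mx_of_solid.
Qed.

Lemma mx_of_solid_tsscpp :
  [&& plane_partition (mx_of_solid P), totally_symmetric (mx_of_solid P)
    & self_complementary (mx_of_solid P)].
Proof.
have [box down symL symR compl] := P_solid.
have row (i j j' : 'I_m) : j <= j' -> mx_of_solid P i j' <= mx_of_solid P i j.
  move=> jj'; rewrite leqNgt ltn_mx_of_solid; apply/negP => Pij'.
  (* The first missing cube above (i, j) would be present: after exchanging the last two
     coordinates, lowering j' to j is a descent. *)
  have : P i j (mx_of_solid P i j).
    by rewrite symR; apply: (down_le _ jj'); [move=> l; apply: down | rewrite -symR].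
  by rewrite -ltn_mx_of_solid ltnn.
apply/and3P; split.
- apply/andP; split.
    by do 3![apply/forallP => ?]; apply/implyP; apply: row.
  have sym (i j : 'I_m) : mx_of_solid P i j = mx_of_solid P j i.
    by apply/val_inj/eq_from_ltn => k; rewrite !ltn_mx_of_solid symL.
  do 3![apply/forallP => ?]; apply/implyP => ?.
  by rewrite sym [X in _ <= nat_of_ord X]sym row.
- have all_sym (x y z : 'I_m) (s : 'S_3) :
      P (cube_of x y z (s (@Ordinal 3 0 isT))) (cube_of x y z (s (@Ordinal 3 1 isT)))
        (cube_of x y z (s (@Ordinal 3 2 isT))) = P x y z.
    have : uniq [:: s (@Ordinal 3 0 isT); s (@Ordinal 3 1 isT); s (@Ordinal 3 2 isT)].
      by rewrite /= !inE !(inj_eq perm_inj).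
    rewrite !ffunE.
    move: (s (@Ordinal 3 0 isT)) (s (@Ordinal 3 1 isT)) (s (@Ordinal 3 2 isT)).
    (* Distinctness leaves six permutations; the goals left open are the two 3-cycles and the
       transposition of the outer coordinates. *)
    do 3![case=> [[|[|[|//]]] ?]] => //= _.
    - by rewrite symR symL.
    - by rewrite symL symR.
    - by rewrite symL symR symL.
  apply/forallP => s; rewrite eqEcard (card_imset _ (@permute_coords_inj s)) leqnn andbT //.
  apply/subsetP => _ /imsetP [c c_in ->]; move: c_in.
  rewrite [c]cubeE.
  by rewrite !inE /coord1 /coord2 /coord3 !ltn_mx_of_solid ![permute_coords _ _ _]ffunE !all_sym !ffunE.
apply/forallP => i; apply/forallP => j; apply/eqP.
have cmp k : k < m ->
    (k < mx_of_solid P (rev_ord i) (rev_ord j)) = (mx_of_solid P i j <= m - k.+1).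
  move=> km; rewrite ltn_mx_of_solid leqNgt ltn_mx_of_solid /=.
  have {1}-> : k = m - (m - k.+1).+1 by lia.
  by apply: compl => //; lia.
have := ltn_ord (mx_of_solid P (rev_ord i) (rev_ord j)); have := ltn_ord (mx_of_solid P i j).
move: cmp; move: (nat_of_ord (mx_of_solid P _ _)) (nat_of_ord (mx_of_solid P _ _)) => a b cmp.
(* Here b is the entry at the opposite position; comparing at heights b - 1 and b forces a + b =
   m. *)
by case: b cmp => [|b] cmp; [case: (posnP m) => [|/cmp]; lia | move=> ? ?; move: (cmp b) (cmp b.+1); lia].
Qed.

End MxOfSolid.

End Cells.

(** * Reduction of a solid to its corner *)

Record corner_solid (n : nat) (A : nat -> nat -> nat -> bool) : Prop := {
  corner_sym : forall i j k, A i j k = A j i k;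
  corner_downM : forall i j k, A i j.+1 k -> A i j k;
  corner_downR : forall i j k, A i j k.+1 -> A i j k;
  corner_bound : forall i j k, A i j k -> j + k.+1 < n }.

Section Corner.

Variable n : nat.

Definition corner (P : nat -> nat -> nat -> bool) i j k := P (n + i) (n + j) k.

(* Up to permutation, a cube with one coordinate at least n is the complement of
   a cube with two such coordinates. *)
Definition unfold_corner (A : nat -> nat -> nat -> bool) i j k :=
  [&& i < 2 * n, j < 2 * n, k < 2 * n &
  match n <= i, n <= j, n <= k with
  | true, true, true => false
  | true, true, false => A (i - n) (j - n) k
  | true, false, true => A (i - n) (k - n) j
  | false, true, true => A (j - n) (k - n) i
  | true, false, false => ~~ A (n - j.+1) (n - k.+1) (2 * n - i.+1)
  | false, true, false => ~~ A (n - i.+1) (n - k.+1) (2 * n - j.+1)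
  | false, false, true => ~~ A (n - i.+1) (n - j.+1) (2 * n - k.+1)
  | false, false, false => true
  end].

Lemma corner_corner_solid P : tssc_solid (2 * n) P -> corner_solid n (corner P).
Proof.
move=> [box down symL symR compl]; rewrite /corner.
have downM i j j' k : j' <= j -> P i j k -> P i j' k.
  by move=> j'j; rewrite !(symR i _ k); apply: down_le => //; apply: down.
have downL i i' j k : i' <= i -> P i j k -> P i' j k.
  by move=> i'i; rewrite !(symL _ j); apply: downM.
split=> [i j k|i j k|i j k|i j k Pijk]; rewrite ?addnS //.
- by apply: downM.
- exact: down.
rewrite ltnNge; apply/negP => le_n.
have /and3P [_ jn _] := box _ _ _ Pijk.
(* This cube dominates a permutation of its complement. *)
have Pc : P n (n + j) (n - j.+1).
  apply: (downL (n + i)); first by lia.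
  by apply: (down_le _ _ Pijk); [move=> l; apply: down | lia].
have := compl n (n + j) (n - j.+1) ltac:(lia) ltac:(lia) ltac:(lia).
rewrite Pc /= => /negP; apply.
have -> : 2 * n - n.+1 = n - 1 by lia.
have -> : 2 * n - (n + j).+1 = n - j.+1 by lia.
have -> : 2 * n - (n - j.+1).+1 = n + j by lia.
by rewrite symR; apply: downL Pc; lia.
Qed.

Lemma unfold_corner_solid A :
  corner_solid n A -> tssc_solid (2 * n) (unfold_corner A).
Proof.
move=> [sym downM downR bound].
have symL i j k : unfold_corner A i j k = unfold_corner A j i k.
  rewrite /unfold_corner.
  case: (leqP n i) => ?; case: (leqP n j) => ?; case: (leqP n k) => ?;
    do 3!case: ltnP => ? //=; by rewrite sym.
have symR i j k : unfold_corner A i j k = unfold_corner A i k j.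
  rewrite /unfold_corner.
  case: (leqP n i) => ?; case: (leqP n j) => ?; case: (leqP n k) => ?;
    do 3!case: ltnP => ? //=; by rewrite sym.
have mono i i' j j' k k' : i' <= i -> j' <= j -> k' <= k -> A i j k -> A i' j' k'.
  move=> i'i j'j k'k Aijk.
  apply: (down_le _ k'k); first by move=> l; apply: downR.
  apply: (@down_le (fun l => A i' l k) j j' _ j'j); first by move=> l; apply: downM.
  rewrite sym; apply: (@down_le (fun l => A j l k) i i' _ i'i); first by move=> l; apply: downM.
  by rewrite sym.
split=> //.
- by move=> i j k /and4P [-> -> -> _].
- move=> i j k /and4P [ilt jlt klt]; rewrite /unfold_corner ilt jlt (ltnW klt) /=.
  case: (leqP n i) => ni; case: (leqP n j) => nj;
    case: (leqP n k) => nk; case: (leqP n k.+1) => nk1 //; try lia.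
  + by apply: downR.
  + by apply: mono; lia.
  (* Here k.+1 = n: the upper cube is read from [A], the lower one from a negation. The bound gives
     i + j + 1 < 2n for the former, and i + j >= 2n if the latter were missing. *)
  + by rewrite sym => /bound ?; apply/negP; rewrite sym => /bound; lia.
  + by apply: contra; apply: mono; lia.
  + by apply: mono; lia.
  + by rewrite sym => /bound ?; apply/negP; rewrite sym => /bound; lia.
  + by apply: contra; apply: mono; lia.
  + by apply: contra; apply: mono; lia.
- move=> i j k ilt jlt klt; rewrite /unfold_corner ilt jlt klt.
  have -> : 2 * n - i.+1 < 2 * n by lia.
  have -> : 2 * n - j.+1 < 2 * n by lia.
  have -> : 2 * n - k.+1 < 2 * n by lia.
  have -> : (n <= 2 * n - i.+1) = (i < n) by lia.
  have -> : (n <= 2 * n - j.+1) = (j < n) by lia.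
  have -> : (n <= 2 * n - k.+1) = (k < n) by lia.
  case: (leqP n i) => ni; case: (leqP n j) => nj;
    case: (leqP n k) => nk //=; rewrite ?negbK; first [congr (~~ A _ _ _) | congr (A _ _ _)]; lia.
Qed.

Lemma eq_unfold_corner A A' i j k :
  (forall x y z, A x y z = A' x y z) -> unfold_corner A i j k = unfold_corner A' i j k.
Proof. by move=> eqA; rewrite /unfold_corner !eqA. Qed.

(** Call a coordinate high if it is at least n. [corner_bound] excludes three high coordinates;
    symmetry and complement reduce every other cube in the box to the corner or to that case. *)
Lemma cornerK P i j k :
  tssc_solid (2 * n) P -> unfold_corner (corner P) i j k = P i j k.
Proof.
move=> solidP; have [box down symL symR compl] := solidP.
have := corner_bound (corner_corner_solid solidP).
rewrite /unfold_corner /corner => bound.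
have high x y z : n <= x -> n <= y -> n <= z -> P x y z = false.
  move=> nx ny nz; apply/negbTE/negP; rewrite -(subnKC nx) -(subnKC ny).
  by move/bound; lia.
have [/and3P [ilt jlt klt]|out] := boolP [&& i < 2 * n, j < 2 * n & k < 2 * n]; last first.
  rewrite (_ : P i j k = false); last by apply/negbTE; apply: contra out; apply: box.
  by apply: contraNF out => /and4P [-> -> -> _].
have compl' := compl _ _ _ ilt jlt klt.
rewrite ilt jlt klt /=.
have low x : x < n -> n + (n - x.+1) = 2 * n - x.+1 by lia.
case: (leqP n i) => ni; case: (leqP n j) => nj; case: (leqP n k) => nk.
- by rewrite high.
- by rewrite !subnKC.
- by rewrite !subnKC // symR.
- by rewrite !low // -[RHS]negbK -compl' symR symL symR symL symR.
- by rewrite !subnKC // symR symL symR symL symR symL.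
- by rewrite !low // -[RHS]negbK -compl' symR.
- by rewrite !low // -[RHS]negbK -compl'.
- by rewrite -[RHS]negbK -compl' high; lia.
Qed.

Lemma corner_unfold A i j k :
  corner_solid n A -> corner (unfold_corner A) i j k = A i j k.
Proof.
move=> [sym downM downR bound]; rewrite /corner /unfold_corner !leq_addr !addKn.
have [Aijk|nA] := boolP (A i j k); last first.
  by case: (leqP n k) => _; rewrite !andbF.
(* The bound is applied to (i, j) and to (j, i), so that both n + i and n + j stay in the box. *)
have := bound _ _ _ Aijk; move: Aijk; rewrite sym => Aijk; have := bound _ _ _ Aijk.
by move=> ? ?; rewrite (leqNgt n k) (_ : k < n) //=; lia.
Qed.

End Corner.

(** * Diagonal lengths of the slices *)

(** Only rows v < n carry information: beyond them [diag] repeats row n - 1 while [wins] vanishes,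
    so round trips are stated for v < n. *)
Record profile (n : nat) (D : nat -> nat -> nat) : Prop := {
  profile_out : forall v u, v <= u -> D v u = 0;
  profile_step : forall v u, D v u.+1 <= D v u <= (D v u.+1).+1;
  profile_mono : forall v u, v.+1 < n -> D v u <= D v.+1 u }.

Section Profile.

Variable n : nat.

Definition diag (A : nat -> nat -> nat -> bool) v u :=
  \sum_(0 <= i < n) A i (i + u) (n - v.+1).

(** In a symmetric slice the cell (i, j) has position [minn i j] on the diagonal of offset |i -
    j|. *)
Definition corner_of (D : nat -> nat -> nat) i j k :=
  (k < n) && (minn i j < D (n - k.+1) (maxn i j - minn i j)).

Lemma corner_downL A i j k : corner_solid n A -> A i.+1 j k -> A i j k.
Proof. by case=> sym downM _ _; rewrite !(sym _ j); apply: downM. Qed.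

Lemma ltn_diag A v u i :
  corner_solid n A -> (i < diag A v u) = A i (i + u) (n - v.+1).
Proof.
move=> solidA; rewrite ltn_sum_down => [|j]; last first.
  by move=> Aj; apply: (corner_downL solidA); apply: (corner_downM solidA).
apply/andP/idP => [[]//|Ai]; split=> //.
by move: Ai; rewrite (corner_sym solidA) => /(corner_bound solidA); lia.
Qed.

(** Down-closure takes (i, i + u + 1) to (i, i + u), and (i + 1, i + 1 + u) to (i, i + u + 1). A
    failing inequality would thus put a cell at a position equal to its diagonal's length. *)
Lemma diag_profile A : corner_solid n A -> profile n (diag A).
Proof.
move=> solidA; have [sym downM downR bound] := solidA.
split=> [v u vu|v u|v u vn].
- by apply: eq_from_ltn => k; rewrite ltn_diag //; apply/negP => /bound; lia.
- apply/andP; split; rewrite leqNgt ltn_diag //; apply/negP => Ai.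
    have : diag A v u < diag A v u by rewrite ltn_diag //; apply: downM; rewrite -addnS.
    by rewrite ltnn.
  have : diag A v u.+1 < diag A v u.+1.
    by rewrite ltn_diag //; apply: (corner_downL solidA); rewrite addnS -addSn.
  by rewrite ltnn.
rewrite leqNgt ltn_diag //; apply/negP => Ai.
have : diag A v.+1 u < diag A v.+1 u.
  by rewrite ltn_diag //; apply: downR; rewrite -subSn.
by rewrite ltnn.
Qed.

Lemma profile_le D v u : profile n D -> D v u <= v - u.
Proof.
move=> [out step _]; case: (leqP v u) => [/out -> //|/ltnW vu].
(* Induction on d with u = v - d, starting from D v v = 0; once d >= v the truncated subtraction
   stays at 0. *)
rewrite -{1}(subKn vu); elim: (v - u) => [|d IHd]; first by rewrite subn0 out.
case: (leqP v d) => vd.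
  by rewrite (_ : v - d.+1 = v - d); [apply: leqW | lia].
have := step v (v - d.+1); have -> : (v - d.+1).+1 = v - d by lia.
by lia.
Qed.

Lemma corner_of_corner_solid D : profile n D -> corner_solid n (corner_of D).
Proof.
move=> profD; have [out step mono] := profD; rewrite /corner_of.
split=> [i j k|i j k|i j k|i j k] /=.
- by rewrite minnC maxnC.
- move=> /andP [-> /=]; set v := n - _.
  (* Raising j leads away from the main diagonal if i <= j and towards it otherwise; each case uses
     one inequality of [profile_step]. *)
  have [ij|ij] := boolP (i <= j).
    have -> : minn i j.+1 = i by lia.
    have -> : minn i j = i by lia.
    have -> : maxn i j.+1 - i = (j - i).+1 by lia.
    have -> : maxn i j - i = j - i by lia.
    by have := step v (j - i); lia.
  have -> : minn i j.+1 = j.+1 by lia.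
  have -> : minn i j = j by lia.
  have -> : maxn i j.+1 - j.+1 = i - j.+1 by lia.
  have -> : maxn i j - j = (i - j.+1).+1 by lia.
  by have := step v (i - j.+1); lia.
- case/andP=> kn ltD; rewrite ltnW //=; apply: (leq_trans ltD).
  have -> : n - k.+1 = (n - k.+2).+1 by lia.
  by apply: mono; lia.
- by case/andP => kn; have := profile_le (n - k.+1) (maxn i j - minn i j) profD; lia.
Qed.

Lemma corner_of_diag A i j k :
  corner_solid n A -> corner_of (diag A) i j k = A i j k.
Proof.
move=> solidA; have [sym _ _ bound] := solidA.
rewrite /corner_of ltn_diag //; case: (ltnP k n) => kn /=; last first.
  by apply/esym/negP => /bound; lia.
have -> : n - (n - k.+1).+1 = k by lia.
have -> : minn i j + (maxn i j - minn i j) = maxn i j by lia.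
by case: (leqP i j) => _ //; rewrite sym.
Qed.

Lemma diag_corner_of D v u :
  profile n D -> v < n -> diag (corner_of D) v u = D v u.
Proof.
move=> profD vn; apply: eq_from_ltn => i.
rewrite ltn_diag; last exact: corner_of_corner_solid.
rewrite /corner_of (_ : n - v.+1 < n); last by lia.
have -> : n - (n - v.+1).+1 = v by lia.
have -> : minn i (i + u) = i by lia.
by have -> : maxn i (i + u) - i = u by lia.
Qed.

(** * Profiles and tournaments *)

Implicit Type T : {ffun 'I_n * 'I_n -> bool}.

Definition beats T v w := extend (fun a b => T (a, b)) v w.

Definition wins T v u := \sum_(u <= w < v) beats T v w.

Definition tournament_of (D : nat -> nat -> nat) : {ffun 'I_n * 'I_n -> bool} :=
  [ffun p : 'I_n * 'I_n =>
     if p.2 < p.1 then D p.1 p.2.+1 < D p.1 p.2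
     else (p.1 < p.2) && ~~ (D p.2 p.1.+1 < D p.2 p.1)].

Lemma upsets_wins T (v u : 'I_n) :
  upsets_with T v (vertices_from_to u v) = wins T v u.
Proof.
have -> : wins T v u = \sum_(u <= w < v | beats T v w) 1.
  by rewrite /wins [RHS]big_mkcond; apply: eq_bigr => w _; case: (beats T v w).
rewrite (big_nat_widen _ _ n) ?(ltnW (ltn_ord v)) // big_geq_mkord /upsets_with -sum1_card.
apply: eq_bigl => w; rewrite !inE /beats extendE.
by rewrite andbC -[RHS]andbA [(u <= w) && _]andbC.
Qed.

Lemma wins_out T v u : v <= u -> wins T v u = 0.
Proof. by move=> vu; rewrite /wins big_geq. Qed.

Lemma wins_rec T v u : u < v -> wins T v u = beats T v u + wins T v u.+1.
Proof. by move=> uv; rewrite /wins big_ltn. Qed.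

Lemma wins_profile T : upset_condition T -> profile n (wins T).
Proof.
move=> T_upset; split=> [||v u vn]; first exact: wins_out.
  move=> v u; case: (ltnP u v) => uv; last by rewrite !wins_out ?(leqW uv).
  by rewrite (wins_rec _ uv); case: (beats T v u); lia.
case: (leqP v u) => uv; first by rewrite wins_out.
have un : u < n by lia.
have := forallP T_upset (Ordinal un).
move=> /forallP /(_ (Ordinal vn)) /forallP /(_ (Ordinal (ltnW vn))).
by rewrite !upsets_wins /= eqxx andbT ltnW.
Qed.

(** Since D v drops by 0 or 1 at each step, the indicator of a drop equals the drop, and the sum
    telescopes to D v u - D v v. *)
Lemma wins_tournament_of D v u :
  profile n D -> v < n -> wins (tournament_of D) v u = D v u.
Proof.
move=> [out step _] vn; case: (leqP v u) => [vu|/ltnW uv]; first by rewrite out ?wins_out.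
rewrite -(subKn uv); elim: (v - u) => [|d IHd]; first by rewrite subn0 out ?wins_out.
case: (leqP v d) => vd.
  by move: IHd; have -> : v - d.+1 = v - d by lia.
have dv : v - d.+1 < v by lia.
rewrite wins_rec //.
rewrite (_ : beats _ v (v - d.+1) = (D v (v - d.+1).+1 < D v (v - d.+1))); last first.
  have wn : v - d.+1 < n by lia.
  by rewrite [LHS](extendE _ (Ordinal vn) (Ordinal wn)) ffunE /= dv.
have := step v (v - d.+1); have -> : (v - d.+1).+1 = v - d by lia.
by rewrite IHd; case: ltnP; lia.
Qed.

Lemma tournament_of_upset D :
  profile n D -> is_tournament (tournament_of D) && upset_condition (tournament_of D).
Proof.
move=> profD; apply/andP; split.
  apply/andP; split; first by apply/forallP => i; rewrite ffunE /= ltnn.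
  apply/forallP => i; apply/forallP => j; apply/implyP => ij.
  by rewrite !ffunE /= ij (ltnNge j) (ltnW ij) negbK.
apply/forallP => u; apply/forallP => v; apply/forallP => p.
apply/implyP => /andP [uv /eqP vp].
rewrite !upsets_wins !wins_tournament_of // vp; apply: (profile_mono profD).
by rewrite -vp.
Qed.

(** Consecutive win counts differ by the outcome of one game. A general [D] is allowed because the
    round trip recovers [wins T] only pointwise and for v < n. *)
Lemma tournament_of_wins T D :
  is_tournament T -> (forall v u, v < n -> D v u = wins T v u) -> tournament_of D = T.
Proof.
move=> /andP [/forallP irr /forallP anti] D_wins.
have lower (v w : 'I_n) : w < v -> (D v w.+1 < D v w) = T (v, w).
  move=> wv; rewrite !D_wins // (wins_rec _ wv).
  rewrite (_ : beats T v w = T (v, w)); last exact: extendE.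
  by case: (T (v, w)); lia.
apply/ffunP => [[v w]]; rewrite ffunE /=.
case: (ltngtP w v) => [wv|vw|/val_inj ->]; first exact: lower.
- rewrite lower //.
  by move/forallP/(_ w)/implyP/(_ vw)/eqP: (anti v) => ->; rewrite negbK.
- by apply/esym/negbTE.
Qed.

End Profile.

Theorem theorem16 (n : nat) (n_ge1 : 1 <= n) :
  exists f : tsscpp n -> upset_tournament n, bijective f.
Proof.
pose D_of (t : tsscpp n) := diag n (corner n (cell (val t))).
have D_corner (t : tsscpp n) : corner_solid n (corner n (cell (val t))).
  by case/and3P: (valP t) => _ ? ?; apply/corner_corner_solid/cell_solid.
pose P_of (T : upset_tournament n) := unfold_corner n (corner_of n (wins (val T))).
have P_corner (T : upset_tournament n) : corner_solid n (corner_of n (wins (val T))).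
  by case/andP: (valP T) => _ ?; apply/corner_of_corner_solid/wins_profile.
have P_solid T : tssc_solid (2 * n) (P_of T) by apply: unfold_corner_solid.
pose f (t : tsscpp n) : upset_tournament n :=
  Sub (tournament_of n (D_of t)) (tournament_of_upset (diag_profile (D_corner t))).
pose g (T : upset_tournament n) : tsscpp n :=
  Sub (mx_of_solid (2 * n) (P_of T)) (mx_of_solid_tsscpp (P_solid T)).
exists f; exists g => [t|T]; apply: val_inj => /=.
  apply: cell_inj => i j k; rewrite cell_mx_of_solid //.
  case/and3P: (valP t) => _ t_sym t_compl.
  rewrite -[RHS](cornerK _ _ _ (cell_solid t_sym t_compl)).
  apply: eq_unfold_corner => {}i {}j {}k.
  rewrite -(corner_of_diag _ _ _ (D_corner t)) /corner_of.
  (* [corner_of] consults only row n - k.+1 < n, where the tournament returns the original diagonal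
     length. *)
  case: ltnP => //= kn; rewrite wins_tournament_of //; last lia.
  exact/diag_profile.
case/andP: (valP T) => T_tour T_upset.
apply: tournament_of_wins T_tour _ => v u vn.
(* With [wins] written as diagonal lengths, it suffices to compare the two corners cell by cell. *)
rewrite -(@diag_corner_of n _ v u (wins_profile T_upset)) //.
apply: eq_bigr => i _; rewrite /corner cell_mx_of_solid //.
by rewrite -(corner_unfold i (i + u) (n - v.+1) (P_corner T)).
Qed.
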